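(* There exist constants $0<\varepsilon_0<\varepsilon_1<1$ such that any non-adaptive $(\varepsilon_0,\varepsilon_1)$-tolerant unateness tester for functions $f\colon\{0,1\}^n\to\{0,1\}$ must make $\widetilde{\Omega}(n^{3/2})$ queries.
   Context: A function $f\colon\{0,1\}^n\to\{0,1\}$ is unate if there is $r\in\{0,1\}^n$ such that $x\mapsto f(x\oplus r)$ is monotone with respect to the coordinatewise partial order. $\mathrm{dist}(f,g)=\Pr_{\boldsymbol x}[f(\boldsymbol x)\ne g(\boldsymbol x)]$ for uniform $\boldsymbol x\in\{0,1\}^n$, and $\mathrm{dist}(f,\mathcal P)=\min_{g\in\mathcal P}\mathrm{dist}(f,g)$. An $(\varepsilon_0,\varepsilon_1)$-tolerant tester for $\mathcal P$ accepts with probability at least $2/3$ if $\mathrm{dist}(f,\mathcal P)\le\varepsilon_0$ and rejects with probability at least $2/3$ if $\mathrm{dist}(f,\mathcal P)>\varepsilon_1$. Non-adaptive means all queries are fixed before any answers are seen. $\widetilde{\Omega}(f)$ means $\Omega(f/\log^c f)$ for an absolute constant $c$. *)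

(* Defs.v *)
From mathcomp Require Import all_boot all_order all_algebra.
From mathcomp Require Import reals.

Set Implicit Arguments.
Unset Strict Implicit.
Unset Printing Implicit Defensive.

Import Order.TTheory GRing.Theory Num.Theory.
Local Open Scope ring_scope.

Definition cube (n : nat) : finType := {ffun 'I_n -> bool}.

Definition boolfun (n : nat) : finType := {ffun cube n -> bool}.

Definition cube_xor n (x r : cube n) : cube n := [ffun i => x i (+) r i].

Definition cube_le n (x y : cube n) : bool := [forall i, x i ==> y i].

Definition monotone n (f : cube n -> bool) : bool :=
  [forall x : cube n, forall y : cube n, cube_le x y ==> (f x ==> f y)].

Definition unate n (f : boolfun n) : bool :=
  [exists r : cube n, monotone (fun x => f (cube_xor x r))].

Definition dist (R : realType) n (f g : boolfun n) : R :=
  #|[pred x : cube n | f x != g x]|%:R / #|cube n|%:R.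

(* Since dist f g <= 1, the default value 1 does not affect the minimum, for
   nonempty P. *)
Definition dist_to (R : realType) n (P : pred (boolfun n)) (f : boolfun n) : R :=
  \big[Order.min/1]_(g : boolfun n | P g) dist R f g.

(* A randomized non-adaptive algorithm: the queries depend on the random seed
   only, the verdict (true = accept) on the seed and the answers.  Finite seed
   spaces lose no generality: for bounded query size there are finitely many
   deterministic algorithms, and a randomized one is a distribution on them. *)
Record nonadaptive_algo (R : realType) (n : nat) := NonadaptiveAlgo {
  seed : finType;
  weight : seed -> R;
  weight_ge0 : forall s, 0 <= weight s;
  weight_sum1 : \sum_(s : seed) weight s = 1;
  queries : seed -> seq (cube n);
  verdict : seed -> seq bool -> bool
}.

Definition accepts (R : realType) n (A : nonadaptive_algo R n) (f : boolfun n)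
    (s : seed A) : bool :=
  verdict s [seq f x | x <- queries s].

Definition pr_accept (R : realType) n (A : nonadaptive_algo R n)
    (f : boolfun n) : R :=
  \sum_(s : seed A | accepts f s) weight s.

Definition pr_reject (R : realType) n (A : nonadaptive_algo R n)
    (f : boolfun n) : R :=
  \sum_(s : seed A | ~~ accepts f s) weight s.

Definition num_queries (R : realType) n (A : nonadaptive_algo R n) : nat :=
  \max_(s : seed A) size (queries s).

Definition tolerant_tester (R : realType) n (eps0 eps1 : R)
    (P : pred (boolfun n)) (A : nonadaptive_algo R n) : Prop :=
  forall f : boolfun n,
    (dist_to R P f <= eps0 -> 2 / 3 <= pr_accept A f) /\
    (eps1 < dist_to R P f -> 2 / 3 <= pr_reject A f).

(* Main.v *)
Require Import Defs.
From mathcomp Require Import all_boot all_order all_algebra.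
From mathcomp Require Import zify ring lra.
From mathcomp Require Import reals sequences exp.

Set Implicit Arguments.
Unset Strict Implicit.
Unset Printing Implicit Defensive.

Import Order.TTheory GRing.Theory Num.Theory.
Local Open Scope ring_scope.

(** Arrange [a * (B + 1)] of the coordinates in [a] blocks.  A hidden shift [s]
designates one action coordinate in each block, the others being control
coordinates.  There are [N = 2 ^ a / 2] terms, each a conjunction of one control
bit per block, chosen so that with constant probability a random control
assignment satisfies exactly one of them.  Where it satisfies only the [i]-th
one, and outside the thin middle layers of the action cube, the function is the
constant [b i] (yes-case) or the xor of [b i] with the majority of the action
bits (no-case), for random bits [b].

The yes-functions are monotone up to the middle layers.  The no-functions contain
many copies of the majority and of its negation, and by Harris' correlation
inequality no choice of orientations suits both.

On a fixed query set the two distributions agree unless two queries satisfy a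
common term and lie on opposite sides of the middle layers.  If the queries
differ in many coordinates they are unlikely to share a term, and if they differ
in few they are unlikely to differ in many hidden action coordinates.  Hence the
number of queries is superpolynomial in [n], in particular larger than
[n ^ (3/2)]. *)

(** * Means and probabilities over finite types *)

Definition mean (R : realFieldType) (X : finType) (f : X -> R) : R :=
  (\sum_x f x) / #|X|%:R.

Notation "\E_ ( x : X ) F" := (mean (fun x : X => F))
  (at level 41, F at level 41, x name, format "'[' \E_ ( x  :  X ) '/  '  F ']'")
  : ring_scope.

Notation "\Pr_ ( x : X ) [ P ]" := (mean (fun x : X => (nat_of_bool P)%:R))
  (at level 0, x name, format "\Pr_ ( x  :  X ) [ P ]") : ring_scope.

Section Mean.
Variables (R : realFieldType) (X : finType).
Implicit Types (f g : X -> R) (P Q S : pred X) (c : R).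

Lemma eq_mean f g : f =1 g -> mean f = mean g.
Proof. by move=> fg; rewrite /mean (eq_bigr g). Qed.

Lemma ler_mean f g : (forall x, f x <= g x) -> mean f <= mean g.
Proof.
by move=> fg; rewrite ler_wpM2r ?invr_ge0 ?ler0n //; apply: ler_sum.
Qed.

Lemma mean_ge0 f : (forall x, 0 <= f x) -> 0 <= mean f.
Proof. by move=> f0; rewrite divr_ge0 ?ler0n ?sumr_ge0. Qed.

Lemma meanD f g : \E_(x : X) (f x + g x) = mean f + mean g.
Proof. by rewrite /mean big_split mulrDl. Qed.

Lemma meanN f : \E_(x : X) - f x = - mean f.
Proof. by rewrite /mean sumrN mulNr. Qed.

Lemma meanZ c f : \E_(x : X) c * f x = c * mean f.
Proof. by rewrite /mean -mulr_sumr mulrA. Qed.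

Lemma mean_sum I (r : seq I) (Q : pred I) (F : I -> X -> R) :
  \E_(x : X) (\sum_(i <- r | Q i) F i x) = \sum_(i <- r | Q i) mean (F i).
Proof. by rewrite /mean exchange_big mulr_suml. Qed.

Lemma mean_cst c : (0 < #|X|)%N -> \E_(x : X) c = c.
Proof.
by move=> X0; rewrite /mean sumr_const -[c *+ _]mulr_natr mulfK // pnatr_eq0 -lt0n.
Qed.

Lemma mean_reindex (h : X -> X) f : injective h -> \E_(x : X) f (h x) = mean f.
Proof. by move=> hI; rewrite /mean [in RHS](reindex_inj hI). Qed.

Lemma prob_le1 P : \Pr_(x : X)[P x] <= 1 :> R.
Proof.
have [X0|X0] := posnP #|X|; first by rewrite /mean X0 invr0 mulr0.
by rewrite -[leRHS](mean_cst 1 X0); apply: ler_mean => x; case: (P x).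
Qed.

Lemma ler_prob P Q :
  (forall x, P x -> Q x) -> \Pr_(x : X)[P x] <= \Pr_(x : X)[Q x] :> R.
Proof.
move=> PQ; apply: ler_mean => x; rewrite ler_nat.
by case: (P x) (PQ x) => // ->.
Qed.

Lemma ler_prob_add P Q S : (forall x, P x -> Q x || S x) ->
  \Pr_(x : X)[P x] <= \Pr_(x : X)[Q x] + \Pr_(x : X)[S x] :> R.
Proof.
move=> PQS; rewrite -meanD; apply: ler_mean => x; rewrite -natrD ler_nat.
by case: (P x) (PQS x) => // /(_ isT); case: (Q x) => //= ->.
Qed.

Lemma prob_has_le (I : Type) (P : X -> pred I) (r : seq I) c :
  (forall i, \Pr_(x : X)[P x i] <= c) ->
  \Pr_(x : X)[has (P x) r] <= (size r)%:R * c.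
Proof.
move=> Pc; elim: r => [|i r IH] /=; first by rewrite mul0r /mean big1 ?mul0r.
apply: (@le_trans _ _ (\Pr_(x : X)[P x i] + \Pr_(x : X)[has (P x) r])).
  exact: ler_prob_add.
by rewrite -natr1 mulrDl mul1r addrC lerD.
Qed.

Lemma exists_le_mean f : (0 < #|X|)%N -> exists x, f x <= mean f.
Proof.
move=> X0; have /card_gt0P[x0 _] := X0.
have [x _ xmin] := @arg_minP _ _ _ x0 xpredT f isT.
by exists x; rewrite -(mean_cst (f x) X0); apply: ler_mean => y; apply: xmin.
Qed.

End Mean.

Section MeanProduct.
Variable R : realFieldType.
Implicit Types (X Y T I J : finType).

Lemma exchange_mean X Y (f : X -> Y -> R) :
  \E_(x : X) (\E_(y : Y) f x y) = \E_(y : Y) (\E_(x : X) f x y).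
Proof.
by rewrite /mean -!mulr_suml exchange_big /= -!mulrA [_^-1 * _]mulrC.
Qed.

Lemma mean_pair X Y (f : X -> Y -> R) :
  \E_(p : X * Y) f p.1 p.2 = \E_(x : X) (\E_(y : Y) f x y).
Proof.
by rewrite /mean -mulr_suml pair_bigA card_prod natrM invfM -mulrA [_^-1 * _]mulrC.
Qed.

Lemma mean_snd X Y (f : Y -> R) :
  (0 < #|X|)%N -> \E_(p : X * Y) f p.2 = mean f.
Proof. by move=> X0; rewrite (mean_pair (fun _ y => f y)) mean_cst. Qed.

Lemma mean_bool (f : bool -> R) : \E_(b : bool) f b = (f true + f false) / 2.
Proof. by rewrite /mean big_bool card_bool. Qed.

Lemma mean_prod I J (F : I -> J -> R) :
  \E_(f : {ffun I -> J}) (\prod_i F i (f i)) = \prod_i \E_(j : J) F i j.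
Proof.
rewrite /mean -bigA_distr_bigA big_split /= prodr_const card_ffun natrX.
by rewrite exprVn.
Qed.

Lemma mean_involution X T (h : X * T -> X * T) (f : X -> R) :
  (0 < #|T|)%N -> involutive h ->
  \E_(x : X) (\E_(t : T) f (h (x, t)).1) = mean f.
Proof.
move=> T0 hK; rewrite -(mean_pair (fun x t => f (h (x, t)).1)).
rewrite -(mean_reindex _ (inv_inj hK)) (eq_mean (g := fun p => f p.1)).
  by rewrite (mean_pair (fun x _ => f x)); apply: eq_mean => x; rewrite mean_cst.
by move=> p; rewrite -surjective_pairing hK.
Qed.

Section Lens.
Variables (X T : finType) (get : X -> T) (set : X -> T -> X).
Hypotheses (get_set : forall x t, get (set x t) = t)
  (set_get : forall x t, set (set x t) (get x) = x).

Lemma mean_lens_set (f : X -> R) :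
  \E_(x : X) (\E_(t : T) f (set x t)) = mean f.
Proof.
have [X0|] := posnP #|X|; first by rewrite /mean X0 invr0 !mulr0.
case/card_gt0P=> x0 _.
have T0 : (0 < #|T|)%N by apply/card_gt0P; exists (get x0).
rewrite -(mean_involution (h := fun p => (set p.1 p.2, get p.1)) f T0) //.
by case=> x t; rewrite /= get_set set_get.
Qed.

Lemma mean_lens_get (f : T -> R) :
  (0 < #|X|)%N -> \E_(x : X) f (get x) = mean f.
Proof.
move=> X0; rewrite -(mean_lens_set (fun x => f (get x))) -[RHS](mean_cst _ X0).
by apply: eq_mean => x; apply: eq_mean => t; rewrite get_set.
Qed.

End Lens.

Lemma mean_ffun_pair I J (i j : I) (f : J -> J -> R) :
  (0 < #|J|)%N -> i != j ->
  \E_(z : {ffun I -> J}) f (z i) (z j) = \E_(u : J) (\E_(v : J) f u v).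
Proof.
move=> J0 ij; rewrite -(mean_pair f).
pose get (z : {ffun I -> J}) := (z i, z j).
pose set (z : {ffun I -> J}) (p : J * J) :=
  [ffun l => if l == i then p.1 else if l == j then p.2 else z l].
apply: (mean_lens_get (get := get) (set := set)).
- by move=> z [u v]; rewrite /get !ffunE eqxx eq_sym (negbTE ij) eqxx.
- move=> z t; apply/ffunP=> l; rewrite !ffunE /=.
  by case: eqP => [->|_] //; case: eqP => [->|].
by rewrite card_ffun expn_gt0 J0.
Qed.

Lemma natr_forall I (P : pred I) :
  [forall i, P i]%:R = \prod_i (P i)%:R :> R.
Proof.
case: forallP => [allP|/forallP]; first by rewrite big1 // => i _; rewrite allP.
by rewrite negb_forall => /existsP[i /negbTE nPi]; rewrite (bigD1 i) //= nPi mul0r.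
Qed.

Lemma prob_forall I J (P : I -> pred J) :
  \Pr_(f : {ffun I -> J})[[forall i, P i (f i)]] = \prod_i \Pr_(j : J)[P i j] :> R.
Proof. by rewrite -mean_prod; apply: eq_mean => f; rewrite natr_forall. Qed.

End MeanProduct.

(** * Resampling bits of the cube *)

Lemma card_cube n : #|cube n| = (2 ^ n)%N.
Proof. by rewrite card_ffun card_bool card_ord. Qed.

Lemma card_cube_gt0 n : (0 < #|cube n|)%N.
Proof. by rewrite card_cube expn_gt0. Qed.

Lemma cube_xorK n (r : cube n) : involutive (fun z => cube_xor z r).
Proof. by move=> z; apply/ffunP=> i; rewrite !ffunE addbK. Qed.

Definition neg n (z : cube n) : cube n := [ffun i => ~~ z i].

Lemma negK n : involutive (@neg n).
Proof. by move=> z; apply/ffunP=> i; rewrite !ffunE negbK. Qed.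

Definition set_bit n (z : cube n) (i : 'I_n) (v : bool) : cube n :=
  [ffun j => if j == i then v else z j].

Lemma set_bitE n (z : cube n) i v : set_bit z i v i = v.
Proof. by rewrite ffunE eqxx. Qed.

Lemma set_bitK n (z : cube n) i v : set_bit (set_bit z i v) i (z i) = z.
Proof. by apply/ffunP=> j; rewrite !ffunE; case: eqP => [->|]. Qed.

Lemma set_bit_set n (z : cube n) i u v :
  set_bit (set_bit z i u) i v = set_bit z i v.
Proof. by apply/ffunP=> j; rewrite !ffunE; case: eqP. Qed.

Definition mix n (A : pred 'I_n) (z w : cube n) : cube n :=
  [ffun i => if A i then w i else z i].

Lemma mix_set_bit n (A : pred 'I_n) z w i v :
  mix A (set_bit z i v) w = if A i then mix A z w else set_bit (mix A z w) i v.
Proof.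
case: ifPn => [|/negbTE] Ai; apply/ffunP=> j; rewrite !ffunE;
  by case: eqP => [->|//]; rewrite Ai.
Qed.

Lemma mix_cons_set_bit n (l : seq 'I_n) z w i v : i \notin l ->
  mix [in i :: l] z (set_bit w i v) = mix [in l] (set_bit z i v) w.
Proof.
move=> /negbTE il; apply/ffunP=> j; rewrite !ffunE inE.
by case: eqP => [->|] //=; rewrite il.
Qed.

Definition increasing_on n (A : pred 'I_n) (f : cube n -> bool) : Prop :=
  forall i z, A i -> f (set_bit z i false) -> f (set_bit z i true).

Definition decreasing_on n (A : pred 'I_n) (f : cube n -> bool) : Prop :=
  forall i z, A i -> f (set_bit z i true) -> f (set_bit z i false).

Lemma increasing_on_mix n (A D : pred 'I_n) (h : cube n -> bool) w :
  increasing_on A h -> increasing_on A (fun z => h (mix D z w)).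
Proof.
by move=> h_inc i z Ai; rewrite !mix_set_bit; case: ifP => // _; apply: h_inc.
Qed.

Lemma unate_oriented n (g : boolfun n) : unate g -> exists r : cube n,
  decreasing_on r g /\ decreasing_on (neg r) (fun z => ~~ g z).
Proof.
case/existsP=> r /forallP g_mono; exists r.
have g_le x y : cube_le (cube_xor x r) (cube_xor y r) -> g x -> g y.
  move=> xy; have /forallP/(_ (cube_xor y r)) := g_mono (cube_xor x r).
  by rewrite xy /= !cube_xorK => /implyP.
split=> i z; rewrite ?ffunE => ri; first apply: g_le; last apply/contra/g_le.
all: apply/forallP=> j; rewrite !ffunE; case: eqP => [->|_]; last exact: implybb.
all: by rewrite ?ri ?(negbTE ri).
Qed.

Section Resampling.
Variables (R : realFieldType) (n : nat).
Implicit Types (z w : cube n) (A : pred 'I_n) (g h : cube n -> bool).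

Lemma mean_set_bit i (f : cube n -> R) :
  \E_(z : cube n) (\E_(v : bool) f (set_bit z i v)) = mean f.
Proof.
apply: (mean_lens_set (get := fun z => z i)) => z v; first exact: set_bitE.
exact: set_bitK.
Qed.

Lemma mean_bit i (f : bool -> R) : \E_(z : cube n) f (z i) = mean f.
Proof.
apply: (mean_lens_get (set := fun z v => set_bit z i v)).
- by move=> z v; apply: set_bitE.
- by move=> z v; apply: set_bitK.
exact: card_cube_gt0.
Qed.

Lemma mean_mix A (f : cube n -> R) :
  \E_(z : cube n) (\E_(w : cube n) f (mix A z w)) = mean f.
Proof.
apply: (mean_involution (h := fun p => (mix A p.1 p.2, mix A p.2 p.1)));
  first exact: card_cube_gt0.
by case=> z w; congr pair; apply/ffunP=> j; rewrite !ffunE; case: (A j).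
Qed.

Lemma prob_neq_resample_bit A g h i :
  decreasing_on A g -> increasing_on A h -> A i ->
  \E_(z : cube n) \Pr_(v : bool)[g z != h (set_bit z i v)] <=
  \Pr_(z : cube n)[g z != h z] :> R.
Proof.
move=> g_dec h_inc Ai; rewrite -(mean_set_bit i) -[leRHS](mean_set_bit i).
apply: ler_mean => z; rewrite !mean_bool !set_bit_set.
have /implyP := g_dec i z Ai; have /implyP := h_inc i z Ai.
by do 2!case: (g _); do 2!case: (h _); move=> //= _ _; lra.
Qed.

(* A form of Harris' inequality: resampling the bits in [A] on the side of [h]
   only destroys the correlation between [g] and [h], which is negative. *)
Lemma prob_neq_resample A g h : decreasing_on A g -> increasing_on A h ->
  \E_(z : cube n) \Pr_(w : cube n)[g z != h (mix A z w)] <=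
  \Pr_(z : cube n)[g z != h z] :> R.
Proof.
move=> g_dec h_inc.
suff seq_le l : uniq l -> all A l ->
    \E_(z : cube n) \Pr_(w : cube n)[g z != h (mix [in l] z w)] <=
    \Pr_(z : cube n)[g z != h z] :> R.
  have A_enum : all A (enum A) by apply/allP=> i; rewrite mem_enum.
  apply: le_trans (seq_le _ (enum_uniq _) A_enum).
  apply: ler_mean => z; apply: ler_mean => w.
  rewrite (_ : mix A z w = mix [in enum A] z w) //.
  by apply/ffunP=> i; rewrite !ffunE /= mem_enum.
elim: l => [_ _|i l IH /= /andP[il ul] /andP[Ai Al]].
  apply: ler_mean => z; rewrite -[leRHS](mean_cst _ (card_cube_gt0 n)).
  apply: ler_mean => w; rewrite (_ : mix [in [::]] z w = z) //.
  by apply/ffunP=> j; rewrite ffunE.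
apply: le_trans (IH ul Al); rewrite [leLHS]exchange_mean [leRHS]exchange_mean.
rewrite -[leLHS](mean_set_bit i); apply: ler_mean => w; rewrite exchange_mean.
under eq_mean => z do under eq_mean => v do rewrite (mix_cons_set_bit _ _ _ il).
apply: (prob_neq_resample_bit (h := fun z => h (mix [in l] z w)) g_dec _ Ai).
exact: increasing_on_mix.
Qed.

Lemma prob_neq_xor_le (r : cube n) g h : decreasing_on r g -> increasing_on r h ->
  \Pr_(z : cube n)[h z != h (cube_xor z r)] <=
  2 * \Pr_(z : cube n)[g z != h z] :> R.
Proof.
move=> g_dec h_inc; apply: (@le_trans _ _
    (2 * \E_(z : cube n) \Pr_(w : cube n)[g z != h (mix r z w)])); last first.
  by rewrite ler_pM2l ?prob_neq_resample.
rewrite -meanZ -(mean_mix r); apply: ler_mean => z.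
have xor_mix w : cube_xor (mix r z w) r = mix r z (neg w).
  by apply/ffunP=> i; rewrite !ffunE; case: (r i); rewrite ?addbT ?addbF.
rewrite mulr_natl mulr2n -[X in _ + X](mean_reindex _ (inv_inj (@negK n))).
apply: ler_prob_add => w; rewrite xor_mix.
by case: (g z); do 2!case: (h _).
Qed.

End Resampling.

(** * Majority and the middle layers *)

Lemma leq_central_bin m j : ('C(m.*2, j) <= 'C(m.*2, m))%N.
Proof.
have low i : (i <= m -> 'C(m.*2, i) <= 'C(m.*2, m))%N.
  move=> im; rewrite -(subKn im); elim: (m - i)%N => [|d IH].
    by rewrite subn0.
  apply: leq_trans IH; have [md|dm] := leqP m d.
    by have -> : (m - d.+1 = m - d)%N by lia.
  have -> : (m - d = (m - d.+1).+1)%N by lia.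
  rewrite -(leq_pmul2l (ltn0Sn (m - d.+1))) mul_bin_left leq_mul2r.
  by apply/orP; right; lia.
have [/low //|mj] := leqP j m; have [jm|/bin_small -> //] := leqP j m.*2.
by rewrite -bin_sub //; apply: low; lia.
Qed.

Lemma central_bin_sqr m : ('C(m.*2, m) ^ 2 * m.*2.+1 <= 16 ^ m)%N.
Proof.
elim: m => // m IH; rewrite doubleS (expnS 16).
have bin_step : (m.+1 * 'C(m.*2.+2, m.+1) = 2 * (m.*2.+1 * 'C(m.*2, m)))%N.
  have down : ((m.*2.+1 - m) * 'C(m.*2.+1, m) = m.*2.+1 * 'C(m.*2, m))%N.
    exact: esym (mul_bin_down _ _).
  rewrite -mul_bin_diag -down; have -> : (m.*2.+1 - m = m.+1)%N by lia.
  by rewrite mulnA mul2n doubleS.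
rewrite -(@leq_pmul2l (m.+1 ^ 2)) // mulnA -expnMn bin_step !expnMn.
have -> : (2 ^ 2 * (m.*2.+1 ^ 2 * 'C(m.*2, m) ^ 2) * m.*2.+3 =
  4 * (m.*2.+1 * m.*2.+3) * ('C(m.*2, m) ^ 2 * m.*2.+1))%N by ring.
by rewrite [leqRHS]mulnA leq_mul //; nia.
Qed.

Definition wt n (z : cube n) : nat := \sum_i z i.

Definition maj n m (z : cube n) : bool := (m < wt z)%N.

Definition mid n m k (z : cube n) : bool := (m <= wt z + k)%N && (wt z <= m + k)%N.

Lemma wt_neg n (z : cube n) : (wt z + wt (neg z) = n)%N.
Proof.
rewrite /wt -big_split -[RHS]card_ord -sum1_card; apply: eq_bigr => i _.
by rewrite ffunE; case: (z i).
Qed.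

Lemma maj_increasing_on n m (A : pred 'I_n) : increasing_on A (maj m).
Proof.
move=> i z _ /leq_trans; apply; apply: leq_sum => j _.
by rewrite !ffunE; case: eqP.
Qed.

Section Majority.
Variable R : realFieldType.

Lemma prob_wt n j : \Pr_(z : cube n)[wt z == j] = 'C(n, j)%:R / 2 ^+ n :> R.
Proof.
rewrite /mean card_cube natrX; congr (_ / _); rewrite -natr_sum; congr _%:R.
have := card_draws 'I_n j; rewrite card_ord => <-.
pose ones (z : cube n) := [set i | z i].
pose indicator (A : {set 'I_n}) : cube n := [ffun i => i \in A].
rewrite -(@on_card_preimset _ _ ones); last first.
  exists indicator; first by move=> z _; apply/ffunP=> i; rewrite ffunE inE.
  by move=> A _; apply/setP=> i; rewrite inE ffunE.
rewrite -sum1_card [RHS]big_mkcond; apply: eq_bigr => z _; rewrite !inE.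
congr (nat_of_bool (_ == _)); rewrite -sum1_card big_mkcond.
by apply: eq_bigr => i _; rewrite inE; case: (z i).
Qed.

Lemma prob_mid_sqr m k :
  \Pr_(z : cube m.*2)[mid m k z] ^+ 2 * m.*2.+1%:R <= k.*2.+1%:R ^+ 2 :> R.
Proof.
set p := mean _; pose c : R := 'C(m.*2, m)%:R / 2 ^+ m.*2.
have p_le : p <= k.*2.+1%:R * c.
  apply: (@le_trans _ _
      (\sum_(d < k.*2.+1) \Pr_(z : cube m.*2)[(wt z + k)%N == (m + d)%N])).
    rewrite -mean_sum; apply: ler_mean => z; rewrite -natr_sum ler_nat /mid.
    case: andP => //= -[wt_ge wt_le].
    have dk : (wt z + k - m < k.*2.+1)%N by lia.
    by rewrite (bigD1 (Ordinal dk)) //= subnKC // eqxx.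
  have -> : k.*2.+1%:R * c = \sum_(d < k.*2.+1) c.
    by rewrite sumr_const card_ord mulr_natl.
  apply: ler_sum => d _.
  apply: (@le_trans _ _ (\Pr_(z : cube m.*2)[wt z == m + d - k]%N)).
    by apply: ler_prob => z; lia.
  by rewrite prob_wt ler_pM2r ?invr_gt0 ?exprn_gt0 // ler_nat leq_central_bin.
have p0 : 0 <= p by apply: mean_ge0 => z; apply: ler0n.
have c_le : c ^+ 2 * m.*2.+1%:R <= 1.
  rewrite expr_div_n mulrAC -!exprM ler_pdivrMr ?exprn_gt0 // mul1r.
  apply: (@le_trans _ _ (16 ^ m)%N%:R).
    by rewrite -natrX -natrM ler_nat central_bin_sqr.
  by rewrite natrX -[16%:R]/((2 ^ 4)%N%:R) natrX -exprM -muln2 -mulnA mulnC.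
apply: (@le_trans _ _ ((k.*2.+1%:R * c) ^+ 2 * m.*2.+1%:R)).
  by rewrite ler_wpM2r // lerXn2r // nnegrE (le_trans p0).
by rewrite exprMn -mulrA ler_piMr // exprn_ge0.
Qed.

Lemma prob_mid_le m k d : ((d * k.*2.+1) ^ 2 <= m.*2.+1)%N ->
  d%:R * \Pr_(z : cube m.*2)[mid m k z] <= 1 :> R.
Proof.
move=> m_ge; set p := mean _; set c : R := k.*2.+1%:R.
have c0 : 0 < c by rewrite ltr0n.
have p0 : 0 <= p by apply: mean_ge0 => z; apply: ler0n.
have sqr_le : (d%:R * p * c) ^+ 2 <= c ^+ 2.
  apply: le_trans (prob_mid_sqr m k); rewrite [d%:R * p]mulrC -mulrA exprMn.
  by rewrite ler_wpM2l ?sqr_ge0 // -natrM -natrX ler_nat.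
have dpc0 : 0 <= d%:R * p * c by do 2!apply: mulr_ge0 => //; apply: ltW.
by rewrite ler_pXn2r ?nnegrE ?(ltW c0) // ger_pMl in sqr_le.
Qed.

(* Flipping the bits in [r] and then the others negates [z], which changes the
   majority unless [z] is balanced. *)
Lemma prob_maj_xor_neg_ge1 m k (r : cube m.*2) :
  1 <= \Pr_(z : cube m.*2)[maj m z != maj m (cube_xor z r)]
       + \Pr_(z : cube m.*2)[maj m z != maj m (cube_xor z (neg r))]
       + \Pr_(z : cube m.*2)[mid m k z] :> R.
Proof.
rewrite -[leLHS](mean_cst 1 (card_cube_gt0 m.*2)).
rewrite -[X in _ + X + _](mean_reindex _ (inv_inj (cube_xorK r))) -!meanD.
apply: ler_mean => z.
have -> : cube_xor (cube_xor z r) (neg r) = neg z.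
  by apply/ffunP=> i; rewrite !ffunE; case: (r i); case: (z i).
rewrite -!natrD ler1n; have := wt_neg z; rewrite /mid /maj.
by move: (wt z) (wt (neg z)) (wt (cube_xor z r)) => u v w; lia.
Qed.

End Majority.

(** * Control terms *)

Lemma bernoulli_ineq (R : realFieldType) (x : R) d :
  -1 <= x -> 1 + d%:R * x <= (1 + x) ^+ d.
Proof.
move=> x_ge; elim: d => [|d IH]; first by rewrite mul0r addr0.
have d0 : 0 <= d%:R :> R := ler0n _ d.
apply: (@le_trans _ _ ((1 + x) * (1 + d%:R * x))); first by rewrite -natr1; nra.
by rewrite exprS ler_wpM2l //; lra.
Qed.

Lemma expr1DV_le (R : realFieldType) c d x : (c.+1 * d <= x)%N ->
  c%:R * (1 + x%:R^-1) ^+ d <= c.+1%:R :> R.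
Proof.
case: x => [|x]; first by case: d => // _; rewrite mulr1 ler_nat.
have x0 : 0 < x.+1%:R :> R by rewrite ltr0n.
rewrite -(ler_nat R) natrM -natr1; set y : R := x.+1%:R in x0 *.
have c0 : 0 <= c%:R :> R := ler0n _ c; move: (c%:R : R) c0 => {}c c0 cd_le.
set p : R := (1 + y^-1) ^+ d; set q : R := (1 - (y + 1)^-1) ^+ d.
have p0 : 0 <= p by rewrite exprn_ge0 // addr_ge0 // invr_ge0 ltW.
have pq : p * q = 1.
  by rewrite -exprMn -[RHS](expr1n _ d); congr (_ ^+ d); field; lra.
have q_ge : 1 + d%:R * - (y + 1)^-1 <= q.
  by apply: bernoulli_ineq; rewrite lerN2 invf_le1; lra.
have d_le : (c + 1) * (d%:R * (y + 1)^-1) <= 1.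
  by rewrite mulrA ler_pdivrMr; lra.
have cq_le : c <= (c + 1) * q by rewrite mulrN in q_ge; nra.
by have := ler_wpM2l p0 cq_le; rewrite [p * (_ * q)]mulrCA pq; lra.
Qed.

Section Bits.
Variables (R : realFieldType) (B : nat).

Lemma prob_bit (c : 'I_B) : \Pr_(u : cube B)[u c] = 1 / 2 :> R.
Proof. by rewrite (mean_bit c (fun v => (nat_of_bool v)%:R)) mean_bool addr0. Qed.

Lemma prob_two_bits (c d : 'I_B) :
  \Pr_(u : cube B)[u c && u d] = (1 + (c == d)%:R) / 4 :> R.
Proof.
have [<-|cd] := eqVneq c d.
  by under eq_mean do rewrite andbb; rewrite prob_bit /=; lra.
pose both u v : R := (nat_of_bool (u && v))%:R.
have B2 : (0 < #|{: bool}|)%N by rewrite card_bool.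
by rewrite (mean_ffun_pair both B2 cd) !mean_bool /both /=; lra.
Qed.

Lemma mean_wt : \E_(u : cube B) (wt u)%:R = B%:R / 2 :> R.
Proof.
under eq_mean do rewrite natr_sum.
rewrite mean_sum; under eq_bigr do rewrite prob_bit.
by rewrite sumr_const card_ord div1r mulr_natl.
Qed.

End Bits.

Section Terms.
Variables (R : realFieldType) (a B : nat).

Definition blocks : finType := {ffun 'I_a -> cube B}.
Definition term : finType := {ffun 'I_a -> 'I_B}.

Definition sat (t : term) (y : blocks) : bool := [forall j, y j (t j)].

Lemma sat_pairE t t' y y' :
  sat t y && sat t' y' = [forall j, y j (t j) && y' j (t' j)].
Proof.
apply/andP/forallP => [[/forallP sat_y /forallP sat_y'] j|sat_both].
  by rewrite sat_y sat_y'.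
by split; apply/forallP=> j; case/andP: (sat_both j).
Qed.

Lemma prob_sat t : \Pr_(y : blocks)[sat t y] = 2 ^- a :> R.
Proof.
rewrite (prob_forall _ (fun j (u : cube B) => u (t j))).
under eq_bigr do rewrite prob_bit div1r.
by rewrite prodr_const card_ord exprVn.
Qed.

Lemma prob_sat_pair t t' : \Pr_(y : blocks)[sat t y && sat t' y] =
  \prod_j ((1 + (t j == t' j)%:R) / 4) :> R.
Proof.
under eq_mean do rewrite sat_pairE.
rewrite (prob_forall _ (fun j (u : cube B) => u (t j) && u (t' j))).
by apply: eq_bigr => j _; apply: prob_two_bits.
Qed.

Lemma mean_prob_sat_pair t :
  \E_(t' : term) \Pr_(y : blocks)[sat t y && sat t' y] =
  ((1 + B%:R^-1) / 4) ^+ a :> R.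
Proof.
under eq_mean do rewrite prob_sat_pair.
rewrite (mean_prod (fun j c => (1 + (t j == c)%:R) / 4)) -[in RHS](card_ord a).
rewrite -prodr_const; apply: eq_bigr => j _.
have B0 : (0 < #|{: 'I_B}|)%N by apply/card_gt0P; exists (t j).
under eq_mean => c do rewrite mulrC.
rewrite meanZ meanD (mean_cst _ B0) mulrC; congr ((_ + _) / _).
rewrite /mean card_ord (bigD1 (t j)) //= eqxx big1 ?addr0 ?div1r // => c.
by rewrite eq_sym => /negbTE ->.
Qed.

Lemma exists_spread_terms N : (0 < B)%N -> exists T : {ffun 'I_N -> term},
  \sum_i \sum_(j | j != i) \Pr_(y : blocks)[sat (T i) y && sat (T j) y] <=
  N%:R ^+ 2 * ((1 + B%:R^-1) / 4) ^+ a :> R.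
Proof.
move=> B0; have term0 : (0 < #|term|)%N by rewrite card_ffun expn_gt0 card_ord B0.
set q : R := _ ^+ a; have q0 : 0 <= q.
  by rewrite exprn_ge0 // divr_ge0 // addr_ge0 // invr_ge0 ler0n.
pose pair_sum (T : {ffun 'I_N -> term}) : R :=
  \sum_i \sum_(j | j != i) \Pr_(y : blocks)[sat (T i) y && sat (T j) y].
have [|T T_le] := exists_le_mean pair_sum.
  by rewrite card_ffun expn_gt0 term0.
exists T; apply: le_trans T_le _; rewrite /pair_sum mean_sum.
apply: (@le_trans _ _ (\sum_(i < N) \sum_(j < N) q)).
  apply: ler_sum => i _; rewrite mean_sum [leRHS](bigID (fun j => j != i)) /=.
  rewrite -[leLHS]addr0 lerD ?sumr_ge0 //; apply: ler_sum => j.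
  rewrite eq_sym => ij; pose joint t t' : R := \Pr_(y : blocks)[sat t y && sat t' y].
  rewrite (mean_ffun_pair joint term0 ij) /joint.
  by under eq_mean do rewrite mean_prob_sat_pair; rewrite mean_cst.
by rewrite !sumr_const !card_ord -mulrnA mulnn -[q *+ _]mulr_natl natrX.
Qed.

End Terms.

(** * Isolated terms *)

Section Isolation.
Variables (R : realFieldType) (a B N : nat).
Variable T : 'I_N -> term a B.
Implicit Type y : blocks a B.

(* A decreasing event of probability close to 1: the functions below keep their
   monotonicity when they are set to 1 outside it. *)
Definition window y : bool :=
  (2 ^ a * \prod_j (wt (y j)).+1 <= 16 * B.+1 ^ a)%N.

Definition nsat y : nat := \sum_i sat (T i) y.

Definition isolated y : bool := window y && (nsat y == 1%N).

Definition selects y i : bool := isolated y && sat (T i) y.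

Lemma sum_selects y : (\sum_i selects y i = isolated y)%N.
Proof.
have [iso|niso] := boolP (isolated y); last first.
  by rewrite big1 // => i _; rewrite /selects (negbTE niso).
case/andP: (iso) => _ /eqP nsat1; rewrite -[RHS]nsat1.
by apply: eq_bigr => i _; rewrite /selects iso.
Qed.

Lemma selects_inj y i j : selects y i -> selects y j -> i = j.
Proof.
move=> yi yj; apply/eqP; apply: contraT => ij.
have := sum_selects y; rewrite (bigD1 i) //= (bigD1 j) 1?eq_sym //= yi yj.
by case: (isolated y).
Qed.

Lemma prob_not_window_le :
  \Pr_(y : blocks a B)[~~ window y] <= (1 + B.+1%:R^-1) ^+ a / 16 :> R.
Proof.
pose density y : R := \prod_j ((wt (y j)).+1%:R / B.+1%:R).
have density0 y : 0 <= density y by rewrite prodr_ge0 // => j _; rewrite divr_ge0.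
have mean_density : \E_(y : blocks a B) density y = ((1 + B.+1%:R^-1) / 2) ^+ a.
  rewrite /density (mean_prod (fun=> fun u : cube B => (wt u).+1%:R / B.+1%:R)).
  rewrite prodr_const card_ord; congr (_ ^+ a).
  under eq_mean => u do rewrite -natr1 mulrC.
  rewrite meanZ meanD mean_wt mean_cst ?card_cube_gt0 //.
  have : 0 < B.+1%:R :> R by rewrite ltr0n.
  by rewrite -[B.+1%:R]natr1 => B0; field; lra.
have -> : (1 + B.+1%:R^-1) ^+ a / 16 = 2 ^+ a / 16 * mean density.
  by rewrite mean_density expr_div_n; field; rewrite expf_neq0 ?pnatr_eq0.
rewrite -meanZ; apply: ler_mean => y; have [|] := boolP (window y) => /=.
  by rewrite mulr_ge0 ?divr_ge0 ?exprn_ge0.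
rewrite -ltnNge => /ltnW wy; rewrite mulrAC ler_pdivlMr // mul1r.
rewrite /density prodf_div prodr_const card_ord mulrA.
rewrite ler_pdivlMr ?exprn_gt0 ?ltr0n //.
by rewrite -!natrX -natr_prod -!natrM ler_nat.
Qed.

Lemma mean_nsat : \E_(y : blocks a B) (nsat y)%:R = N%:R / 2 ^+ a :> R.
Proof.
under eq_mean do rewrite natr_sum.
rewrite mean_sum; under eq_bigr do rewrite prob_sat.
by rewrite sumr_const card_ord mulr_natl.
Qed.

Lemma mean_nsat_sqr : \E_(y : blocks a B) (nsat y)%:R ^+ 2 =
  N%:R / 2 ^+ a +
  \sum_i \sum_(j | j != i) \Pr_(y : blocks a B)[sat (T i) y && sat (T j) y] :> R.
Proof.
under eq_mean do rewrite natr_sum expr2 big_distrlr /=.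
rewrite mean_sum -mean_nsat.
under [X in X + _]eq_mean do rewrite natr_sum.
rewrite [X in X + _]mean_sum -big_split /=; apply: eq_bigr => i _.
rewrite mean_sum (bigD1 i) //=; congr (_ + _).
  by apply: eq_mean => y; rewrite -natrM mulnb andbb.
by apply: eq_bigr => j _; apply: eq_mean => y; rewrite -natrM mulnb.
Qed.

(* Second moment: [1{Z = 1} >= 2 Z - Z ^ 2] for [Z = nsat y], of mean 1/2. *)
Lemma prob_isolated_ge : (20 * a <= B)%N -> (2 * N = 2 ^ a)%N ->
  \sum_i \sum_(j | j != i) \Pr_(y : blocks a B)[sat (T i) y && sat (T j) y] <=
    N%:R ^+ 2 * ((1 + B%:R^-1) / 4) ^+ a :> R ->
  1 / 8 <= \Pr_(y : blocks a B)[isolated y] :> R.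
Proof.
move=> aB N2 pairs_le.
have {}N2 : 2 * N%:R = 2 ^+ a :> R by rewrite -natrM N2 natrX.
have pow0 : 0 < 2 ^+ a :> R by rewrite exprn_gt0.
have Nmean : N%:R / 2 ^+ a = 1 / 2 :> R by rewrite -N2; field; lra.
have pairs_le_const : N%:R ^+ 2 * ((1 + B%:R^-1) / 4) ^+ a <= 5 / 19 :> R.
  have -> : N%:R ^+ 2 * ((1 + B%:R^-1) / 4) ^+ a =
      (N%:R / 2 ^+ a) ^+ 2 * (1 + B%:R^-1) ^+ a :> R.
    rewrite expr_div_n.
    have -> : 4 ^+ a = (2 ^+ a) ^+ 2 :> R by rewrite exprAC; congr (_ ^+ a); ring.
    by field; rewrite expf_neq0 ?pnatr_eq0.
  by rewrite Nmean; have := expr1DV_le R (c := 19) aB; lra.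
have window_le : (1 + B.+1%:R^-1) ^+ a / 16 <= 20 / 19 / 16 :> R.
  by have := expr1DV_le R (c := 19) (leqW aB); lra.
have moments : 2 * (N%:R / 2 ^+ a) - \E_(y : blocks a B) (nsat y)%:R ^+ 2 <=
    \Pr_(y : blocks a B)[isolated y] + \Pr_(y : blocks a B)[~~ window y] :> R.
  rewrite -mean_nsat -meanZ -meanN -!meanD; apply: ler_mean => y.
  have := ler0n R (nsat y).-2.
  by rewrite /isolated; case: (window y); case: (nsat y) => [|[|z]] /=;
     rewrite -?(natr1 _ z.+1) -?(natr1 _ z); nra.
by rewrite mean_nsat_sqr Nmean in moments; have := prob_not_window_le; lra.
Qed.

End Isolation.

Lemma exists_isolating_terms (R : realFieldType) a B N :
  (0 < B)%N -> (20 * a <= B)%N -> (2 * N = 2 ^ a)%N ->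
  exists T : 'I_N -> term a B, 1 / 8 <= \Pr_(y : blocks a B)[isolated T y] :> R.
Proof.
move=> B0 aB N2; have [T T_spread] := exists_spread_terms R a N B0.
by exists T; apply: prob_isolated_ge.
Qed.

(** * Random signs *)

Section RandomSigns.
Variables (R : realFieldType) (N : nat) (v : 'I_N -> R).

Definition part (b : cube N) : R := \sum_i (b i)%:R * v i.

Lemma part_neg b : part b + part (neg b) = \sum_i v i.
Proof.
rewrite -big_split; apply: eq_bigr => i _.
by rewrite ffunE; case: (b i) => /=; ring.
Qed.

Lemma mean_part_sub_sqr :
  \E_(b : cube N) (part b - part (neg b)) ^+ 2 = \sum_i v i ^+ 2.
Proof.
have part_sub b : part b - part (neg b) = \sum_i (-1) ^+ (~~ b i) * v i.
  rewrite -sumrB; apply: eq_bigr => i _.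
  by rewrite ffunE; case: (b i) => /=; ring.
under eq_mean do rewrite part_sub expr2 big_distrlr /=.
rewrite mean_sum; apply: eq_bigr => i _; rewrite mean_sum (bigD1 i) //=.
rewrite big1 ?addr0 => [|j ji].
  rewrite -[RHS](mean_cst _ (card_cube_gt0 N)); apply: eq_mean => b.
  by case: (b i) => /=; ring.
pose prod_term s t : R := (-1) ^+ (~~ s) * v i * ((-1) ^+ (~~ t) * v j).
rewrite (mean_ffun_pair prod_term _ (_ : i != j)) ?card_bool 1?eq_sym //.
by rewrite !mean_bool /prod_term /=; field.
Qed.

Definition unbalanced (b : cube N) : bool :=
  (4 * part b < \sum_i v i) || (4 * part (neg b) < \sum_i v i).

(* Chebyshev's inequality for the difference of the two parts of the sum. *)
Lemma prob_unbalanced c :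
  0 < \sum_i v i -> (forall i, 0 <= v i <= c * \sum_j v j) ->
  \Pr_(b : cube N)[unbalanced b] <= 4 * c.
Proof.
set V := \sum_i v i => V0 v_bounds.
have chebyshev (b : cube N) :
    V ^+ 2 * (unbalanced b)%:R <= 4 * (part b - part (neg b)) ^+ 2.
  rewrite /unbalanced -/V; have := part_neg b; rewrite -/V => parts.
  have [/orP[]|_] := boolP (_ || _); last by rewrite mulr0 mulr_ge0 ?sqr_ge0.
    by rewrite mulr1 -parts in V0 *; nra.
  by rewrite mulr1 -parts in V0 *; nra.
have sqr_le : \sum_i v i ^+ 2 <= c * V * V.
  rewrite mulr_sumr; apply: ler_sum => i _.
  by have /andP[v0 vc] := v_bounds i; rewrite expr2 ler_wpM2r.
have := ler_mean chebyshev; rewrite !meanZ mean_part_sub_sqr => V_le.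
rewrite -(@ler_pM2l _ (V ^+ 2)) ?exprn_gt0 //; apply: le_trans V_le _.
by rewrite mulrCA expr2 mulrAC [V * c]mulrC ler_pM2l.
Qed.

End RandomSigns.

(** * The hard functions *)

Section Restriction.
Variables (n : nat) (J : finType) (phi : J -> 'I_n).

Definition pull (x : cube n) : {ffun J -> bool} := [ffun j => x (phi j)].

Definition push (x : cube n) (w : {ffun J -> bool}) : cube n :=
  [ffun i => if [pick j | phi j == i] is Some j then w j else x i].

Hypothesis phi_inj : injective phi.

Lemma pull_push x w : pull (push x w) = w.
Proof.
apply/ffunP=> j; rewrite !ffunE; case: pickP => [j' /eqP/phi_inj -> //|/(_ j)].
by rewrite eqxx.
Qed.

Lemma push_pull x w : push (push x w) (pull x) = x.
Proof.
apply/ffunP=> i; rewrite ffunE; case: pickP => [j /eqP <-|phi_i].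
  by rewrite ffunE.
by rewrite ffunE; case: pickP => // j; rewrite phi_i.
Qed.

Variable R : realFieldType.

Lemma mean_pull (f : {ffun J -> bool} -> R) : \E_(x : cube n) f (pull x) = mean f.
Proof. exact: (mean_lens_get pull_push push_pull f (card_cube_gt0 n)). Qed.

Lemma mean_push (f : cube n -> R) :
  \E_(x : cube n) (\E_(w : {ffun J -> bool}) f (push x w)) = mean f.
Proof. exact: (mean_lens_set pull_push push_pull). Qed.

End Restriction.

Lemma push_set_bit n a (phi : 'I_a -> 'I_n) x (w : cube a) j v :
  injective phi -> push phi x (set_bit w j v) = set_bit (push phi x w) (phi j) v.
Proof.
move=> phi_inj; apply/ffunP=> i; rewrite !ffunE.
case: pickP => [j' /eqP <-|phi_i]; first by rewrite ffunE (inj_eq phi_inj).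
by rewrite eq_sym phi_i.
Qed.

Lemma decreasing_on_push n a (phi : 'I_a -> 'I_n) (r x : cube n)
    (g : cube n -> bool) :
  injective phi -> decreasing_on r g ->
  decreasing_on (pull phi r : cube a) (fun w => g (push phi x w)).
Proof.
by move=> phi_inj g_dec j w; rewrite ffunE !push_set_bit // => /g_dec; apply.
Qed.

Section Addressing.
Variables (R : realFieldType) (a B N n : nat).
Variables (T : 'I_N -> term a B) (iota : 'I_a * 'I_B.+1 -> 'I_n).
Hypothesis iota_inj : injective iota.

Definition shift : finType := {ffun 'I_a -> 'I_B.+1}.

Definition act_coord (s : shift) (j : 'I_a) : 'I_n := iota (j, s j).

(* Adding the nonzero [lift ord0 p.2] modulo [B.+1] avoids [act_coord s p.1]. *)
Definition ctl_coord (s : shift) (p : 'I_a * 'I_B) : 'I_n :=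
  iota (p.1, s p.1 + lift ord0 p.2).

Definition act (s : shift) (x : cube n) : cube a := pull (act_coord s) x.

Definition ctl (s : shift) (x : cube n) : blocks a B :=
  [ffun j => [ffun c => pull (ctl_coord s) x (j, c)]].

Lemma actE s x j : act s x j = x (iota (j, s j)).
Proof. by rewrite ffunE. Qed.

Lemma ctlE s x j c : ctl s x j c = x (iota (j, s j + lift ord0 c)).
Proof. by rewrite !ffunE. Qed.

Lemma act_coord_inj s : injective (act_coord s).
Proof. by move=> j j' /iota_inj[]. Qed.

Lemma ctl_coord_inj s : injective (ctl_coord s).
Proof.
move=> [j c] [j' c'] /iota_inj eq_coord; have /= eq_j := congr1 fst eq_coord.
by have /= := congr1 snd eq_coord; rewrite -eq_j => /addrI/lift_inj ->.
Qed.

Lemma act_ctl_coord s j p : act_coord s j != ctl_coord s p.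
Proof.
apply/negP=> /eqP/iota_inj eq_coord; have /= eq_j := congr1 fst eq_coord.
have /= := congr1 snd eq_coord; rewrite -eq_j -[LHS]addr0 => /addrI.
by apply/eqP; apply: neq_lift.
Qed.

Lemma act_push s x z : act s (push (act_coord s) x z) = z.
Proof. exact: pull_push (@act_coord_inj s) x z. Qed.

Lemma ctl_push s x z : ctl s (push (act_coord s) x z) = ctl s x.
Proof.
apply/ffunP=> j; apply/ffunP=> c; rewrite !ffunE.
case: pickP => // j' /eqP eq_coord.
by case/negP: (act_ctl_coord s j' (j, c)); apply/eqP.
Qed.

Lemma mean_act s (f : cube a -> R) : \E_(x : cube n) f (act s x) = mean f.
Proof. exact: (mean_pull (@act_coord_inj s)). Qed.

Lemma mean_ctl s (f : blocks a B -> R) : \E_(x : cube n) f (ctl s x) = mean f.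
Proof.
pose flat (y : blocks a B) := [ffun p : 'I_a * 'I_B => y p.1 p.2].
apply: (mean_lens_get (set := fun x y => push (ctl_coord s) x (flat y))).
- move=> x y; rewrite /ctl pull_push; last exact: ctl_coord_inj.
  by apply/ffunP=> j; apply/ffunP=> c; rewrite !ffunE.
- move=> x y; have -> : flat (ctl s x) = pull (ctl_coord s) x.
    by apply/ffunP=> -[j c]; rewrite !ffunE.
  by apply: push_pull; apply: ctl_coord_inj.
exact: card_cube_gt0.
Qed.

Definition address (s : shift) (f : 'I_N -> cube a -> bool) : boolfun n :=
  [ffun x => [|| ~~ window (ctl s x), (1 < nsat T (ctl s x))%N |
     [exists i, sat (T i) (ctl s x) && f i (act s x)]]].

Lemma address_selects s f x i :
  selects T (ctl s x) i -> address s f x = f i (act s x).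
Proof.
move=> sel_i; have /andP[/andP[wx /eqP nsat1] sat_i] := sel_i.
rewrite ffunE wx nsat1 /=; apply/existsP/idP => [[j /andP[sat_j]]|fi]; last first.
  by exists i; rewrite sat_i.
by rewrite (@selects_inj _ _ _ T (ctl s x) i j) // /selects /isolated wx nsat1.
Qed.

Lemma sat_le t (y y' : blocks a B) :
  (forall j, cube_le (y j) (y' j)) -> sat t y -> sat t y'.
Proof.
move=> yy' /forallP sat_y; apply/forallP=> j.
by have /forallP/(_ (t j))/implyP := yy' j; apply.
Qed.

Lemma wt_le d (z z' : cube d) : cube_le z z' -> (wt z <= wt z')%N.
Proof.
by move=> /forallP zz'; apply: leq_sum => i _; case: (z i) (zz' i) => //= ->.
Qed.

Lemma window_le (y y' : blocks a B) :
  (forall j, cube_le (y j) (y' j)) -> window y' -> window y.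
Proof.
move=> yy'; apply: leq_trans; rewrite leq_mul2l; apply/orP; right.
by apply: leq_prod => j _; apply: wt_le.
Qed.

Lemma address_unate s f : (forall i, monotone (f i)) -> unate (address s f).
Proof.
move=> f_mono; apply/existsP; exists [ffun=> false].
have xor0 x : cube_xor x [ffun=> false] = x :> cube n.
  by apply/ffunP=> i; rewrite !ffunE addbF.
apply/forallP=> x; apply/forallP=> x'; rewrite !xor0; apply/implyP=> /forallP xx'.
have ctl_le j : cube_le (ctl s x j) (ctl s x' j).
  by apply/forallP=> c; rewrite !ctlE; apply: xx'.
have act_le : cube_le (act s x) (act s x').
  by apply/forallP=> j; rewrite !actE; apply: xx'.
rewrite !ffunE; apply/implyP=> /or3P[nw|many|/existsP[i /andP[sat_i fi]]];
  apply/or3P.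
- by constructor 1; apply: contra nw; apply: window_le.
- constructor 2; apply: leq_trans many _; apply: leq_sum => i _.
  by case: (sat _ _) (@sat_le (T i) _ _ ctl_le) => // ->.
- constructor 3; apply/existsP; exists i; rewrite (sat_le ctl_le sat_i).
  have /forallP/(_ (act s x))/forallP/(_ (act s x')) := f_mono i.
  by rewrite act_le fi.
Qed.

Lemma prob_address_neq_le s f f' :
  \Pr_(x : cube n)[address s f x != address s f' x] <=
  \Pr_(z : cube a)[[exists i, f i z != f' i z]] :> R.
Proof.
rewrite -(mean_act s); apply: ler_prob => x; apply: contraTT => /existsPn eq_f.
rewrite negbK !ffunE; apply/eqP; do 2!congr (_ || _); apply: eq_existsb => i.
by have /negPn/eqP -> := eq_f i.
Qed.

Lemma prob_address_neq_ge s f (g : cube n -> bool) (d : 'I_N -> R) :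
  (forall i x, d i <= \Pr_(z : cube a)[f i z != g (push (act_coord s) x z)]) ->
  \sum_i \Pr_(y : blocks a B)[selects T y i] * d i <=
  \Pr_(x : cube n)[address s f x != g x].
Proof.
move=> d_le; rewrite -(mean_push (@act_coord_inj s)).
under eq_bigr => i _ do rewrite -(mean_ctl s) mulrC -meanZ.
rewrite -mean_sum; apply: ler_mean => x.
have [i sel_i|none] := pickP (selects T (ctl s x)); last first.
  by rewrite big1 ?mean_ge0 // => i _; rewrite none mulr0.
rewrite (bigD1 i) //= sel_i mulr1 big1 ?addr0 => [|j ji]; last first.
  by apply/eqP; rewrite mulf_eq0 pnatr_eq0 eqb0 orbC; apply/orP; left;
     apply: contra ji => /(selects_inj sel_i) ->.
apply: le_trans (d_le i x) _; apply: ler_prob => z.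
by rewrite (@address_selects _ _ _ i) ?ctl_push ?act_push.
Qed.

End Addressing.

Section HardFunctions.
Variables (R : realFieldType) (m k B N n : nat).
Variables (T : 'I_N -> term m.*2 B) (iota : 'I_m.*2 * 'I_B.+1 -> 'I_n).
Hypothesis iota_inj : injective iota.
Implicit Types (s : shift m.*2 B) (b : cube N).

Definition yes_action b (i : 'I_N) (z : cube m.*2) : bool := ~~ mid m k z && b i.

Definition no_action b (i : 'I_N) (z : cube m.*2) : bool :=
  ~~ mid m k z && (b i (+) maj m z).

Definition yes_fun s b : boolfun n := address T iota s (yes_action b).

Definition no_fun s b : boolfun n := address T iota s (no_action b).

Definition term_mass (i : 'I_N) : R := \Pr_(y : blocks m.*2 B)[selects T y i].

Lemma sum_term_mass : \sum_i term_mass i = \Pr_(y : blocks m.*2 B)[isolated T y].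
Proof.
by rewrite -mean_sum; apply: eq_mean => y; rewrite -natr_sum sum_selects.
Qed.

Lemma yes_fun_close s b : exists2 g : boolfun n, unate g &
  \Pr_(x : cube n)[yes_fun s b x != g x] <= \Pr_(z : cube m.*2)[mid m k z] :> R.
Proof.
exists (address T iota s (fun i _ => b i)).
  apply: address_unate => i; apply/forallP=> z; apply/forallP=> z'.
  by rewrite implybb implybT.
apply: le_trans (prob_address_neq_le _ _ iota_inj _ _ _) _.
apply: ler_prob => z /existsP[i]; rewrite /yes_action.
by case: (mid _ _ _); case: (b i).
Qed.

Definition maj_sensitivity (r : cube m.*2) : R :=
  \Pr_(z : cube m.*2)[maj m z != maj m (cube_xor z r)].

Lemma no_action_far b i (r : cube m.*2) (g : cube m.*2 -> bool) :
  decreasing_on r (fun z => b i (+) g z) ->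
  maj_sensitivity r / 2 - \Pr_(z : cube m.*2)[mid m k z] <=
  \Pr_(z : cube m.*2)[no_action b i z != g z].
Proof.
move=> g_dec; have := prob_neq_xor_le R g_dec (@maj_increasing_on _ m r).
rewrite -/(maj_sensitivity r).
have : \Pr_(z : cube m.*2)[b i (+) g z != maj m z] <=
    \Pr_(z : cube m.*2)[mid m k z] +
    \Pr_(z : cube m.*2)[no_action b i z != g z] :> R.
  apply: ler_prob_add => z; rewrite /no_action.
  by case: (mid _ _ _) => //; case: (b i); case: (g z); case: (maj _ _).
lra.
Qed.

Lemma prob_no_fun_neq_ge s b (g : boolfun n) : unate g -> exists p : cube m.*2,
  part term_mass b *
    (maj_sensitivity (neg p) / 2 - \Pr_(z : cube m.*2)[mid m k z]) +
  part term_mass (neg b) *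
    (maj_sensitivity p / 2 - \Pr_(z : cube m.*2)[mid m k z]) <=
  \Pr_(x : cube n)[no_fun s b x != g x] :> R.
Proof.
move=> /unate_oriented[r [g_dec ng_dec]].
have act_inj := @act_coord_inj _ _ _ _ iota_inj s.
pose p : cube m.*2 := pull (act_coord iota s) r; exists p.
have neg_p : neg p = pull (act_coord iota s) (neg r).
  by apply/ffunP=> j; rewrite !ffunE.
set e : R := \Pr_(z : cube m.*2)[mid m k z].
pose orient i := if b i then neg p else p.
have far i x : maj_sensitivity (orient i) / 2 - e <= \Pr_(z : cube m.*2)
    [no_action b i z != g (push (act_coord iota s) x z)].
  apply: no_action_far; rewrite /orient; case: (b i); last first.
    exact: decreasing_on_push.
  by rewrite neg_p; apply: (decreasing_on_push (g := fun x => ~~ g x)).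
apply: le_trans (prob_address_neq_ge T iota_inj far).
rewrite !mulr_suml -big_split; apply: ler_sum => i _.
by rewrite /orient ffunE; case: (b i) => /=; rewrite -/(term_mass i); lra.
Qed.

Lemma no_fun_far s b (g : boolfun n) : unate g ->
  \Pr_(z : cube m.*2)[mid m k z] <= 1 / 200 :> R ->
  1 / 8 <= \Pr_(y : blocks m.*2 B)[isolated T y] :> R ->
  ~~ unbalanced term_mass b ->
  1 / 100 < \Pr_(x : cube n)[no_fun s b x != g x] :> R.
Proof.
move=> /(prob_no_fun_neq_ge s b)[p dist_ge] mid_le iso_ge.
rewrite /unbalanced negb_or -!leNgt -(part_neg _ b) => /andP[u_ge v_ge].
rewrite -sum_term_mass -(part_neg _ b) in iso_ge; apply: lt_le_trans dist_ge.
move: u_ge v_ge iso_ge mid_le (prob_maj_xor_neg_ge1 R k p).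
rewrite -/(maj_sensitivity p) -/(maj_sensitivity (neg p)).
have S_ge0 q : 0 <= maj_sensitivity q by apply: mean_ge0 => z; apply: ler0n.
move: (part term_mass b) (part term_mass (neg b)) (S_ge0 p) (S_ge0 (neg p)) => u v.
move: (maj_sensitivity p) (maj_sensitivity (neg p)) (mean _) => S S' e *.
have : (u + v) * S' <= 4 * u * S' by rewrite ler_wpM2r.
have : (u + v) * S <= 4 * v * S by rewrite ler_wpM2r.
have : (u + v) * (1 - e) <= (u + v) * (S + S') by rewrite ler_pM2l; lra.
have : (u + v) * e <= (u + v) * (1 / 200) by rewrite ler_pM2l; lra.
lra.
Qed.

End HardFunctions.

(** * Collisions *)

Section Densities.
Variables (R : realFieldType) (a B n : nat) (iota : 'I_a * 'I_B.+1 -> 'I_n).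
Implicit Types (s : shift a B) (x : cube n).

Local Notation act := (act iota).
Local Notation ctl := (ctl iota).

Definition common x x' (j : 'I_a) : R :=
  \Pr_(e : 'I_B.+1)[x (iota (j, e)) && x' (iota (j, e))].

Definition differ x x' (j : 'I_a) : R :=
  \Pr_(e : 'I_B.+1)[x (iota (j, e)) != x' (iota (j, e))].

Lemma common_ge0 x x' j : 0 <= common x x' j.
Proof. by apply: mean_ge0 => e; apply: ler0n. Qed.

Lemma differ_ge0 x x' j : 0 <= differ x x' j.
Proof. by apply: mean_ge0 => e; apply: ler0n. Qed.

Lemma prod_common_window s x : window (ctl s x) ->
  \prod_j common x x j <= 16 / 2 ^+ a.
Proof.
move=> wx; apply: (@le_trans _ _ (\prod_j ((wt (ctl s x j)).+1%:R / B.+1%:R))).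
  apply: ler_prod => j _; rewrite common_ge0 /common /mean card_ord.
  rewrite ler_pM2r ?invr_gt0 ?ltr0n // -natr_sum ler_nat.
  rewrite (reindex_inj (addrI (s j))) big_ord_recl -[leqRHS]add1n.
  rewrite leq_add ?leq_b1 //.
  by apply: leq_sum => c _; rewrite andbb ctlE.
rewrite prodf_div prodr_const card_ord ler_pdivrMr ?exprn_gt0 ?ltr0n //.
rewrite mulrAC ler_pdivlMr ?exprn_gt0 // mulrC.
by rewrite -!natrX -natr_prod -!natrM ler_nat.
Qed.

Lemma common_differ x x' j :
  common x x' j ^+ 2 * (1 + differ x x' j) <= common x x j * common x' x' j.
Proof.
pose only (z z' : cube n) : R :=
  \Pr_(e : 'I_B.+1)[z (iota (j, e)) && ~~ z' (iota (j, e))].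
have only_ge0 z z' : 0 <= only z z' by apply: mean_ge0 => e; apply: ler0n.
have -> : common x x j = common x x' j + only x x'.
  by rewrite -meanD; apply: eq_mean => e; case: (x _); case: (x' _) => /=; ring.
have -> : common x' x' j = common x x' j + only x' x.
  by rewrite -meanD; apply: eq_mean => e; case: (x _); case: (x' _) => /=; ring.
have -> : differ x x' j = only x x' + only x' x.
  by rewrite -meanD; apply: eq_mean => e; case: (x _); case: (x' _) => /=; ring.
have : common x x' j <= 1 := prob_le1 _ _.
have := common_ge0 x x' j; have := only_ge0 x x'; have := only_ge0 x' x.
move: (common _ _ _) (only _ _) (only _ _) => p u v *.
by have : p ^+ 2 <= p; nra.
Qed.

Lemma prod_common_differ x x' :
  (\prod_j common x x' j) ^+ 2 * \prod_j (1 + differ x x' j) <=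
  (\prod_j common x x j) * \prod_j common x' x' j.
Proof.
rewrite -prodrXl -!big_split; apply: ler_prod => j _.
by rewrite common_differ mulr_ge0 ?exprn_ge0 ?common_ge0 ?addr_ge0 ?differ_ge0.
Qed.

Lemma prod_common_differ_window s x x' : window (ctl s x) -> window (ctl s x') ->
  (2 ^+ a * \prod_j common x x' j) ^+ 2 * \prod_j (1 + differ x x' j) <= 16 ^+ 2.
Proof.
move=> wx wx'; have pow0 : 0 < 2 ^+ a :> R by rewrite exprn_gt0.
have -> : 16 ^+ 2 = (2 ^+ a) ^+ 2 * (16 / 2 ^+ a) ^+ 2 :> R by field; lra.
rewrite exprMn -mulrA ler_pM2l ?exprn_gt0 // [leRHS]expr2.
apply: le_trans (prod_common_differ x x') _.
by rewrite ler_pM ?prodr_ge0 ?prod_common_window ?(prod_common_window wx)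
  ?(prod_common_window wx') // => j _; apply: common_ge0.
Qed.

Lemma prob_sat_shift t x x' :
  \Pr_(s : shift a B)[sat t (ctl s x) && sat t (ctl s x')] =
  \prod_j common x x' j.
Proof.
pose both j (e : 'I_B.+1) :=
  x (iota (j, e + lift ord0 (t j))) && x' (iota (j, e + lift ord0 (t j))).
transitivity (\Pr_(s : shift a B)[[forall j, both j (s j)]] : R).
  apply: eq_mean => s; rewrite sat_pairE; congr (nat_of_bool _)%:R.
  by apply: eq_forallb => j; rewrite !ctlE.
rewrite (prob_forall _ both); apply: eq_bigr => j _.
exact: (mean_reindex (fun e => (x (iota (j, e)) && x' (iota (j, e)))%:R)
  (addIr (lift ord0 (t j)))).
Qed.

Definition act_dist s x x' : nat := \sum_j (act s x j != act s x' j).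

Lemma mean_exp_act_dist x x' :
  \E_(s : shift a B) 2 ^+ act_dist s x x' = \prod_j (1 + differ x x' j).
Proof.
pose factor j (e : 'I_B.+1) : R := 1 + (x (iota (j, e)) != x' (iota (j, e)))%:R.
transitivity (\E_(s : shift a B) \prod_j factor j (s j)).
  apply: eq_mean => s; rewrite /act_dist.
  rewrite (big_morph _ (exprD (2 : R)) (expr0 2)); apply: eq_bigr => j _.
  by rewrite !actE /factor; case: (_ != _) => /=; ring.
rewrite mean_prod; apply: eq_bigr => j _.
by rewrite meanD mean_cst ?card_ord.
Qed.

End Densities.

Section Collision.
Variables (R : realFieldType) (m k B N n : nat).
Local Notation a := m.*2.
Variables (T : 'I_N -> term a B) (iota : 'I_a * 'I_B.+1 -> 'I_n).
Implicit Types (s : shift a B) (x : cube n).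

Local Notation act := (act iota).
Local Notation ctl := (ctl iota).

Definition share_term s x x' : bool :=
  [exists i, sat (T i) (ctl s x) && sat (T i) (ctl s x')].

Definition collide s x x' : bool :=
  [&& window (ctl s x), window (ctl s x'), share_term s x x',
      (wt (act s x) + k < m)%N & (m + k < wt (act s x'))%N].

Lemma prob_share_term_le x x' :
  \Pr_(s : shift a B)[share_term s x x'] <= N%:R * \prod_j common R iota x x' j.
Proof.
apply: (@le_trans _ _
    (\sum_i \Pr_(s : shift a B)[sat (T i) (ctl s x) && sat (T i) (ctl s x')])).
  rewrite -mean_sum; apply: ler_mean => s; rewrite -natr_sum ler_nat.
  have [/existsP[i sat_i]|//] := boolP (share_term s x x').
  by rewrite (bigD1 i) //= sat_i.
under [leLHS]eq_bigr do rewrite prob_sat_shift.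
by rewrite sumr_const card_ord mulr_natl.
Qed.

Lemma collide_act_dist_ge s x x' : collide s x x' -> (k.*2 <= act_dist iota s x x')%N.
Proof.
case/and5P=> _ _ _ lo hi.
have : (wt (act s x') <= wt (act s x) + act_dist iota s x x')%N.
  rewrite -big_split; apply: leq_sum => j _.
  by case: (act s x j); case: (act s x' j).
by lia.
Qed.

Lemma prob_collide_le_differ x x' :
  4 ^+ k * \Pr_(s : shift a B)[collide s x x'] <=
  \prod_j (1 + differ R iota x x' j).
Proof.
rewrite -mean_exp_act_dist -meanZ; apply: ler_mean => s.
have [/collide_act_dist_ge far|_] := boolP (collide s x x').
  by rewrite mulr1 -[4]/((2 ^ 2)%:R) natrX -exprM mul2n ler_eXn2l // ltr1n.
by rewrite mulr0 exprn_ge0.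
Qed.

(* If [V = \prod_j (1 + differ x x' j)] and [p] is the probability of a collision,
   sharing a term gives [(2 * p) ^+ 2 * V <= 16 ^+ 2] and separation by the middle
   layers gives [4 ^+ k * p <= V]. *)
Lemma prob_collide_le x x' : (2 * N = 2 ^ a)%N ->
  4 ^+ k * \Pr_(s : shift a B)[collide s x x'] ^+ 3 <= 64 :> R.
Proof.
move=> N2; set p : R := mean _.
have p0 : 0 <= p by apply: mean_ge0 => s; apply: ler0n.
have [/existsP[s0 /and5P[wx wx' _ _ _]]|/existsPn none] :=
    boolP [exists s, collide s x x']; last first.
  rewrite (_ : p = 0) ?expr0n ?mulr0 ?ler0n // /p /mean big1 ?mul0r // => s _.
  by rewrite (negbTE (none s)).
have share_le : 2 * p <= 2 ^+ a * \prod_j common R iota x x' j.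
  rewrite -natrX -N2 natrM -mulrA ler_pM2l //.
  by apply: le_trans (prob_share_term_le x x'); apply: ler_prob => s /and5P[].
have := prob_collide_le_differ x x'; have := prod_common_differ_window R wx wx'.
rewrite -/p; move: share_le; set W := 2 ^+ a * _; set V := \prod_j (1 + _).
move=> pW WV pV.
have V0 : 0 <= V by apply: le_trans pV; rewrite mulr_ge0 ?exprn_ge0.
have sqr_le : (2 * p) ^+ 2 <= W ^+ 2 by rewrite lerXn2r // nnegrE; lra.
have : (2 * p) ^+ 2 * (4 ^+ k * p) <= 16 ^+ 2.
  apply: le_trans WV; apply: le_trans (ler_wpM2l (sqr_ge0 _) pV) _.
  exact: ler_wpM2r.
by lra.
Qed.

Definition collides s (Q : seq (cube n)) : bool :=
  has (fun x => has (collide s x) Q) Q.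

Lemma prob_collides_le c Q : (2 * N = 2 ^ a)%N -> 0 <= c -> 64 <= 4 ^+ k * c ^+ 3 ->
  \Pr_(s : shift a B)[collides s Q] <= (size Q)%:R ^+ 2 * c :> R.
Proof.
move=> N2 c0 c_ge; rewrite expr2 -mulrA.
apply: (@prob_has_le R (shift a B) _ (fun s x => has (collide s x) Q)) => x.
apply: (@prob_has_le R (shift a B) _ (fun s x' => collide s x x')) => x'.
rewrite -(@ler_pXn2r _ 3) ?nnegrE // ?mean_ge0 //.
rewrite -(@ler_pM2l _ (4 ^+ k)) ?exprn_gt0 //.
exact: le_trans (prob_collide_le _ _ N2) c_ge.
Qed.

(* Flipping [b i] for the terms [i] satisfied by a query above the middle layers
   turns one function into the other on [Q]. *)
Lemma hard_fun_indistinguishable s (Q : seq (cube n)) : ~~ collides s Q ->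
  exists r : cube N, forall b x, x \in Q ->
    yes_fun k T iota s b x = no_fun k T iota s (cube_xor b r) x.
Proof.
move=> no_collision.
pose above i x :=
  [&& window (ctl s x), sat (T i) (ctl s x) & (m + k < wt (act s x))%N].
exists [ffun i => has (above i) Q] => b x xQ; rewrite !ffunE.
case wx: (window _) => //=; congr (_ || _); apply: eq_existsb => i.
case sat_x: (sat _ _) => //=; rewrite /yes_action /no_action.
case not_mid: (mid _ _ _) => //=; rewrite !ffunE.
suff -> : has (above i) Q = maj m (act s x) by case: (b i); case: (maj _ _).
have [hi|lo] : (m + k < wt (act s x))%N \/ (wt (act s x) + k < m)%N.
- by move/negbT: not_mid; rewrite /mid negb_and -!ltnNge => /orP[]; [right|left].
- have -> : maj m (act s x) by apply: leq_ltn_trans hi; apply: leq_addr.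
  by apply/hasP; exists x; rewrite // /above wx sat_x.
have -> : maj m (act s x) = false by rewrite /maj; lia.
apply: contraNF no_collision => /hasP[x' x'Q /and3P[wx' sat_x' hi]].
apply/hasP; exists x => //; apply/hasP; exists x' => //.
rewrite /collide /share_term wx wx' lo hi /= andbT.
by apply/existsP; exists i; rewrite sat_x.
Qed.

End Collision.

(** * Query lower bounds *)

Lemma dist_prob (R : realType) n (f g : boolfun n) :
  dist R f g = \Pr_(x : cube n)[f x != g x].
Proof.
by rewrite /dist /mean -natr_sum -sum1_card big_mkcond.
Qed.

Section Tester.
Variables (R : realType) (n : nat) (A : nonadaptive_algo R n).

Lemma pr_accept_reject f : pr_accept A f + pr_reject A f = 1.
Proof. by rewrite -(weight_sum1 A) [RHS](bigID (accepts f)). Qed.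

Lemma pr_accept_le1 f : pr_accept A f <= 1.
Proof.
by rewrite -(pr_accept_reject f) lerDl sumr_ge0 // => w _; apply: weight_ge0.
Qed.

Lemma mean_pr_accept (H : finType) (F : H -> boolfun n) :
  \E_(h : H) pr_accept A (F h) =
  \sum_(w : seed A) weight w * \Pr_(h : H)[accepts (F h) w].
Proof.
rewrite /pr_accept; under eq_mean do rewrite big_mkcond /=.
rewrite mean_sum; apply: eq_bigr => w _; rewrite -meanZ; apply: eq_mean => h.
by case: (accepts _ w); rewrite ?mulr1 ?mulr0.
Qed.

(* Yao's principle: for each fixed seed the two random functions yield similar
   verdicts, hence so they do for the tester. *)
Lemma tolerant_tester_advantage (H : finType) (F G : H -> boolfun n)
    (P : pred (boolfun n)) (eps0 eps1 c d : R) : (0 < #|H|)%N ->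
  tolerant_tester eps0 eps1 P A ->
  (forall h, dist_to R P (F h) <= eps0) ->
  \Pr_(h : H)[~~ (eps1 < dist_to R P (G h))] <= c ->
  (forall w : seed A, \Pr_(h : H)[accepts (F h) w] <=
    \Pr_(h : H)[accepts (G h) w] + d) ->
  1 / 3 <= c + d.
Proof.
move=> H0 tester close far_but_c indist.
have yes : 2 / 3 <= \E_(h : H) pr_accept A (F h).
  rewrite -[leLHS](mean_cst _ H0); apply: ler_mean => h.
  exact: (tester (F h)).1 (close h).
have no : \E_(h : H) pr_accept A (G h) <= 1 / 3 + c.
  apply: (@le_trans _ _ (\E_(h : H) (1 / 3 + (~~ (eps1 < dist_to R P (G h)))%:R))).
    apply: ler_mean => h; have [far|_] := boolP (eps1 < _); last first.
      by have := pr_accept_le1 (G h); rewrite /=; lra.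
    have := (tester (G h)).2 far; have := pr_accept_reject (G h).
    by rewrite /=; lra.
  by rewrite meanD mean_cst // lerD2l.
have gap : \E_(h : H) pr_accept A (F h) <= \E_(h : H) pr_accept A (G h) + d.
  have -> : d = \sum_(w : seed A) weight w * d.
    by rewrite -mulr_suml weight_sum1 mul1r.
  rewrite !mean_pr_accept -big_split /=.
  by apply: ler_sum => w _; rewrite -mulrDr ler_wpM2l ?weight_ge0.
lra.
Qed.

End Tester.

Section LowerBound.
Variables (R : realType) (n m k B N : nat) (c : R) (A : nonadaptive_algo R n).
Local Notation a := m.*2.
Variables (T : 'I_N -> term a B) (iota : 'I_a * 'I_B.+1 -> 'I_n).
Hypotheses (iota_inj : injective iota) (N2 : (2 * N = 2 ^ a)%N).
Hypotheses (c0 : 0 <= c) (c_ge : 64 <= 4 ^+ k * c ^+ 3).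
Hypotheses (m_ge : (5 <= m)%N)
  (mid_small : \Pr_(z : cube a)[mid m k z] <= 1 / 200 :> R)
  (T_isolating : 1 / 8 <= \Pr_(y : blocks a B)[isolated T y] :> R).

Lemma prob_unbalanced_terms :
  \Pr_(b : cube N)[unbalanced (term_mass R T) b] <= 1 / 12 :> R.
Proof.
apply: (@le_trans _ _ (4 * (8 / 2 ^+ a))).
  apply: prob_unbalanced => [|i]; rewrite sum_term_mass.
    by apply: lt_le_trans T_isolating; lra.
  rewrite mean_ge0 //=; apply: (@le_trans _ _ (2 ^- a)).
    by rewrite -(prob_sat _ (T i)); apply: ler_prob => y /andP[].
  have pow0 : 0 < 2 ^- a :> R by rewrite invr_gt0 exprn_gt0.
  by move: T_isolating pow0; nra.
rewrite mulrA ler_pdivrMr ?exprn_gt0 //.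
have : (2 ^ 10)%:R <= 2 ^+ a :> R by rewrite -natrX ler_nat leq_exp2l //; lia.
by rewrite natrX; lra.
Qed.

Lemma dist_to_yes_fun_le s b : dist_to R (@unate n) (yes_fun k T iota s b) <= 1 / 200.
Proof.
have [g g_unate close] := yes_fun_close R k T iota_inj s b.
apply: le_trans (bigmin_le_cond 1 (dist R _) g_unate) _.
by rewrite dist_prob; apply: le_trans mid_small.
Qed.

Lemma dist_to_no_fun_gt s b : ~~ unbalanced (term_mass R T) b ->
  1 / 100 < dist_to R (@unate n) (no_fun k T iota s b).
Proof.
move=> balanced; apply: lt_bigmin => [|g g_unate]; first by lra.
by rewrite dist_prob no_fun_far.
Qed.

Lemma prob_accepts_yes_le (w : seed A) :
  \Pr_(h : shift a B * cube N)[accepts (yes_fun k T iota h.1 h.2) w] <=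
  \Pr_(h : shift a B * cube N)[accepts (no_fun k T iota h.1 h.2) w] +
  (num_queries A)%:R ^+ 2 * c.
Proof.
pose acc (f : shift a B -> cube N -> boolfun n) s b : R := (accepts (f s b) w)%:R.
rewrite (mean_pair (acc (yes_fun k T iota))) (mean_pair (acc (no_fun k T iota))).
apply: (@le_trans _ _ (\E_(s : shift a B)
    (\E_(b : cube N) acc (no_fun k T iota) s b +
     (collides k T iota s (queries w))%:R))).
  apply: ler_mean => s; have [_|no_collision] := boolP (collides _ _ _ _ _).
    by apply: le_trans (prob_le1 _ _) _; rewrite lerDr mean_ge0.
  have [r indist] := hard_fun_indistinguishable no_collision.
  rewrite addr0 -[leRHS](mean_reindex _ (inv_inj (cube_xorK r))).
  apply: ler_mean => b; rewrite /acc /accepts.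
  have /eq_in_map -> // : {in queries w,
      yes_fun k T iota s b =1 no_fun k T iota s (cube_xor b r)}.
  by move=> x; apply: indist.
rewrite meanD lerD2l; apply: le_trans (prob_collides_le T iota _ N2 c0 c_ge) _.
rewrite ler_wpM2r // lerXn2r ?nnegrE ?ler0n // ler_nat.
exact: (leq_bigmax_cond w).
Qed.

Lemma num_queries_sqr_ge : tolerant_tester (1 / 200) (1 / 100) (@unate n) A ->
  1 / 4 <= (num_queries A)%:R ^+ 2 * c.
Proof.
have shift0 : (0 < #|shift a B|)%N by rewrite card_ffun expn_gt0 card_ord.
move=> tester; have hidden0 : (0 < #|{: shift a B * cube N}|)%N.
  by rewrite card_prod muln_gt0 card_cube_gt0 shift0.
have advantage := tolerant_tester_advantage hidden0 tester
  (fun h => dist_to_yes_fun_le h.1 h.2) _ prob_accepts_yes_le.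
have : 1 / 3 <= 1 / 12 + (num_queries A)%:R ^+ 2 * c; last by lra.
apply: advantage; apply: le_trans prob_unbalanced_terms.
rewrite -(mean_snd (fun b => (unbalanced (term_mass R T) b)%:R) shift0).
by apply: ler_prob => h; apply: contraNT; apply: dist_to_no_fun_gt.
Qed.

End LowerBound.

Definition half_blocks (l : nat) : nat := (200 * (3 * l).*2.+1) ^ 2.

Definition grid_size (l : nat) : nat :=
  (half_blocks l).*2 * (20 * (half_blocks l).*2).+1.

Lemma expn_dominates C d : (0 < d)%N ->
  exists l0, forall l, (l0 <= l -> C * l.+1 ^ d <= 2 ^ l)%N.
Proof.
move=> d0; exists (d.+1 * (C * d.+1 ^ d))%N => l l_ge; pose t := (l %/ d.+1)%N.
have t_ge : (C * d.+1 ^ d <= t)%N by rewrite leq_divRL // mulnC.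
have l_le : (l.+1 <= d.+1 * 2 ^ t)%N.
  apply: (@leq_trans (d.+1 * t.+1)); first by rewrite mulnC ltn_ceil.
  by rewrite leq_mul2l ltn_expl.
apply: (@leq_trans (C * (d.+1 * 2 ^ t) ^ d)).
  by rewrite leq_mul2l leq_exp2r // l_le orbT.
apply: (@leq_trans (2 ^ (t * d.+1))); last by rewrite leq_exp2l // leq_divM.
rewrite expnMn mulnA mulnS expnD expnM leq_mul2r; apply/orP; right.
by apply: leq_trans t_ge _; apply: ltnW; apply: ltn_expl.
Qed.

Lemma grid_size_le : exists K, forall l, (grid_size l <= K * l.+1 ^ 4)%N.
Proof.
have [c blocks_le] : exists c, forall l, ((half_blocks l).*2 <= c * l.+1 ^ 2)%N.
  exists (2 * (200 * 7) ^ 2)%N => l.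
  by rewrite -mul2n -mulnA leq_mul2l -expnMn leq_sqr /=; lia.
exists (21 * c ^ 2)%N => l; apply: (@leq_trans (21 * (half_blocks l).*2 ^ 2)).
  have : (0 < half_blocks l)%N by rewrite expn_gt0.
  by rewrite /grid_size -mulnn; nia.
by rewrite -mulnA leq_mul2l (expnM _ 2 2) -expnMn leq_sqr blocks_le.
Qed.

Lemma num_queries_ge_grid (R : realType) n (A : nonadaptive_algo R n) l :
  (grid_size l <= n)%N -> tolerant_tester (1 / 200) (1 / 100) (@unate n) A ->
  (2 ^ l <= 4 * num_queries A)%N.
Proof.
move=> grid_le tester; pose m := half_blocks l; pose B := (20 * m.*2)%N.
have m_ge : (5 <= m)%N.
  by apply: (@leq_trans (200 ^ 2)); rewrite // leq_sqr leq_pmulr.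
have N2 : (2 * 2 ^ m.*2.-1 = 2 ^ m.*2)%N by rewrite -expnS prednK //; lia.
have B0 : (0 < B)%N by rewrite /B; lia.
have [T T_isolating] := exists_isolating_terms R B0 (leqnn B) N2.
have card_le : (#|{: 'I_m.*2 * 'I_B.+1}| <= n)%N by rewrite card_prod !card_ord.
pose iota (p : 'I_m.*2 * 'I_B.+1) : 'I_n := widen_ord card_le (enum_rank p).
have iota_inj : injective iota.
  by move=> p q /(congr1 val) /= /ord_inj /enum_rank_inj.
have mid_small : \Pr_(z : cube m.*2)[mid m (3 * l) z] <= 1 / 200 :> R.
  have : 200 * \Pr_(z : cube m.*2)[mid m (3 * l) z] <= 1 :> R; last by lra.
  by apply: prob_mid_le; rewrite -/(half_blocks l) -/m; lia.
pose c : R := 4 / 4 ^+ l; have pow0 : 0 < 4 ^+ l :> R by rewrite exprn_gt0.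
have c0 : 0 <= c by rewrite divr_ge0 // ltW.
have c_ge : 64 <= 4 ^+ (3 * l) * c ^+ 3.
  rewrite mulnC exprM (_ : _ * _ = 64) //.
  by rewrite /c; field; rewrite gt_eqF.
have := num_queries_sqr_ge iota_inj N2 c0 c_ge m_ge mid_small T_isolating tester.
rewrite mulrA ler_pdivlMr // => bound; rewrite -leq_sqr -(ler_nat R) !natrX natrM.
by rewrite exprAC -natrX; lra.
Qed.

Lemma num_queries_ge_expn (R : realType) d : (0 < d)%N -> exists N : nat,
  forall n (A : nonadaptive_algo R n), (N <= n)%N ->
  tolerant_tester (1 / 200) (1 / 100) (@unate n) A ->
  (n ^ d <= num_queries A)%N.
Proof.
move=> d0; have [K grid_size_le_K] := grid_size_le.
have d4 : (0 < 4 * d)%N by rewrite muln_gt0.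
have [l0 dominates] := expn_dominates (4 * (K * 2 ^ 4) ^ d) d4.
exists (grid_size l0) => n A n_ge tester.
have l_le_n l : (grid_size l <= n -> l <= n)%N.
  by apply: leq_trans; rewrite /grid_size /half_blocks -mulnn; nia.
have some_grid : exists l, (grid_size l <= n)%N by exists l0.
have [l grid_le l_max] := ex_maxnP some_grid l_le_n.
have n_lt : (n < grid_size l.+1)%N.
  by rewrite ltnNge; apply/negP => /l_max; rewrite ltnn.
rewrite -(@leq_pmul2l 4) //; apply: leq_trans (num_queries_ge_grid grid_le tester).
apply: leq_trans (dominates l (l_max _ n_ge)); rewrite -mulnA leq_mul2l /=.
rewrite expnM -expnMn leq_exp2r //.
apply: leq_trans (ltnW n_lt) _; apply: leq_trans (grid_size_le_K _) _.
by rewrite -mulnA leq_mul2l -expnMn leq_exp2r //; lia.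
Qed.

Lemma powR_div_ln_le (R : realType) (x p c : R) :
  1 <= p -> 0 <= c -> expR 1 <= x -> x `^ p / ln (x `^ p) `^ c <= x `^ p.
Proof.
move=> p1 c0 x_ge; have x0 : 0 < x := lt_le_trans (expR_gt0 1) x_ge.
have ln_x : 1 <= ln x by rewrite -[leLHS]expRK ler_ln // posrE expR_gt0.
have ln_ge : 1 <= ln (x `^ p) by rewrite ln_powR; nra.
have pow_ge : 1 <= ln (x `^ p) `^ c.
  by rewrite -[leLHS](powRr0 (ln (x `^ p))) ler_powR.
by rewrite ler_pdivrMr ?ler_peMr ?powR_ge0 // (lt_le_trans _ pow_ge).
Qed.

Theorem theorem1p5 (R : realType) :
  exists eps0 eps1 : R,
    [/\ 0 < eps0, eps0 < eps1 & eps1 < 1] /\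
    exists (K c : R) (N : nat),
      [/\ 0 < K, 0 < c &
          forall (n : nat) (A : nonadaptive_algo R n),
            (N <= n)%N ->
            tolerant_tester eps0 eps1 (@unate n) A ->
            K * (n%:R `^ (3 / 2) / (ln (n%:R `^ (3 / 2))) `^ c)
              <= (num_queries A)%:R].
Proof.
exists (1 / 200), (1 / 100); split; first by split; lra.
have [N queries_ge] := num_queries_ge_expn R (isT : 0 < 2)%N.
exists 1, 1, (maxn N (Num.truncn (expR 1 : R)).+1); split=> // n A.
rewrite geq_max => /andP[Nn n_gt] tester.
have n_ge : expR 1 <= n%:R :> R.
  by apply: le_trans (ltW (truncnS_gt _)) _; rewrite ler_nat.
rewrite mul1r; apply: le_trans (powR_div_ln_le _ ler01 n_ge) _; first lra.
apply: (@le_trans _ _ (n%:R `^ 2)).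
  by apply: ler_powR; [rewrite ler1n; case: (n) n_gt | lra].
by rewrite powR_mulrn ?ler0n // -natrX ler_nat queries_ge.
Qed.
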